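(* Let $N,\omega\in\mathbb{N}$, $\tau\in\mathbb{N}_0$, and for $i,j,l\in\{1,\ldots,N\}$ let $c_i:\mathbb{N}_0\to(-1,1)$, $\tau_{ijl},\xi_{ijl}:\mathbb{N}_0\to\mathbb{N}_0$ and $a_{ij},b_{ijl}:\mathbb{N}_0\to\mathbb{R}$ be $\omega$-periodic functions, and let $f_j,g_j:\mathbb{R}\to\mathbb{R}$ be functions such that, for each $j$, there are constants $F_j$, $G_j$ and $m_j>0$ with $|f_j(x)-f_j(y)|\le F_j|x-y|$, $|g_j(x)-g_j(y)|\le G_j|x-y|$ and $|g_j(x)|\le m_j$ for all $x,y\in\mathbb{R}$. Put $c_i^+=\sup_m|c_i(m)|$, $a_{ij}^+=\sup_m|a_{ij}(m)|$, $b_{ijl}^+=\sup_m|b_{ijl}(m)|$. If there is $\overline d=(d_1,\ldots,d_N)$ with $d_i>0$ for all $i$ such that $$d_i(1-c_i^+)>\sum_{j=1}^N\left(d_jF_ja_{ij}^++\sum_{l=1}^N b_{ijl}^+\big(m_jd_lG_l+m_ld_jG_j\big)\right)\qquad\text{for all }i\in\{1,\ldots,N\},$$ then the model $$x_i(m+1)=c_i(m)x_i(m-\tau)+\sum_{j=1}^N a_{ij}(m)f_j(x_j(m))+\sum_{j=1}^N\sum_{l=1}^N b_{ijl}(m)\,g_j\big(x_j(m-\tau_{ijl}(m))\big)\,g_l\big(x_l(m-\xi_{ijl}(m))\big),$$ $m\in\mathbb{N}_0$, $i\in\{1,\ldots,N\}$, has a unique $\omega$-periodic solution, and this solution is globally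 exponentially stable.
   Context: $\mathbb{N}=\{1,2,\ldots\}$, $\mathbb{N}_0=\mathbb{N}\cup\{0\}$. Put $r=-\max_{i,j,l,m}\{\tau_{ijl}(m),\xi_{ijl}(m),\tau\}$ (maximum over all indices and all times $m\in\mathbb{N}_0$). For $I\subseteq\mathbb{R}$, $I_{\mathbb{Z}}=I\cap\mathbb{Z}$. $X$ is the space of functions $\alpha:[r,0]_{\mathbb{Z}}\to\mathbb{R}$ with norm $\|\alpha\|=\max_{j=r,\ldots,0}|\alpha(j)|$. $X^N$ carries the norm $\|\overline\alpha\|=\max_{i=1,\ldots,N}\|\alpha_i\|$. For $\overline{x}=(x_1,\ldots,x_N):[r,+\infty)_{\mathbb{Z}}\to\mathbb{R}^N$ and $m\in\mathbb{N}_0$, $\overline{x}_m\in X^N$ is defined by $\overline{x}_m(j)=\overline{x}(m+j)$, $j=r,\ldots,0$. For $\overline\alpha\in X^N$, $\overline{x}(\cdot,\overline\alpha)$ is the unique solution with $\overline{x}_0=\overline\alpha$, and $\overline{x}_m(\cdot,\overline\alpha)$ is its segment at time $m$. A function $g$ on $\mathbb{N}_0$ is $\omega$-periodic if $g(m+\omega)=g(m)$ for all $m\in\mathbb{N}_0$; an $\omega$-periodic solution is a solution $\overline{x}^*$ with $\overline{x}^*(m+\omega)=\overline{x}^*(m)$ for all integers $m\ge r$. A solution $\overline{x}^*$ is globally exponentially stable if there are $C>0$ and $\zeta\in(0,1)$ such that $\|\overline{x}_m(\cdot,\overline\alpha)-\overline{x}^*_m\|\le C\zeta^m\|\overline\alpha-\overline{x}^*_0\|$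 for all $\overline\alpha\in X^N$ and $m\in\mathbb{N}_0$. *)

(* Defs.v *)
(* MathComp-Analysis; the reals are an arbitrary R : realType. *)
From HB Require Import structures.
From mathcomp Require Import all_boot all_order all_algebra.
From mathcomp Require Import all_classical all_reals.

Set Implicit Arguments.
Unset Strict Implicit.
Unset Printing Implicit Defensive.

Import Order.TTheory GRing.Theory Num.Theory.
Local Open Scope classical_set_scope.
Local Open Scope ring_scope.

Definition nat_periodic (T : Type) (omega : nat) (u : nat -> T) : Prop :=
  forall m : nat, u (m + omega)%N = u m.

(* u^+ = sup_m |u m| *)
Definition sup_abs (R : realType) (u : nat -> R) : R :=
  sup (range (fun m : nat => `|u m|)).

Definition delays (N tau : nat) (dtau dxi : 'I_N -> 'I_N -> 'I_N -> nat -> nat)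
  : set nat :=
  [set k | k = tau \/ exists i j l m, k = dtau i j l m \/ k = dxi i j l m].

(* The greatest element of [delays]. The default value 0 is used only if the
   delays are unbounded, which periodicity excludes. The earliest time r is
   - max_delay. *)
Definition max_delay (N tau : nat)
    (dtau dxi : 'I_N -> 'I_N -> 'I_N -> nat -> nat) : nat :=
  xget 0%N [set k | delays tau dtau dxi k /\
                    forall k', delays tau dtau dxi k' -> (k' <= k)%N].

(* Functions on the integer interval [-q, 0]: the value at the time -k is stored
   at the index k : 'I_q.+1. *)
Definition history (R : realType) (q : nat) : Type := 'I_q.+1 -> R.

Definition history_norm (R : realType) (q : nat) (alpha : history R q) : R :=
  \big[Num.max/0]_(k < q.+1) `|alpha k|.

Definition histories (R : realType) (N q : nat) : Type := 'I_N -> history R q.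

Definition histories_norm (R : realType) (N q : nat)
    (alpha : histories R N q) : R :=
  \big[Num.max/0]_(i < N) history_norm (alpha i).

Definition histories_sub (R : realType) (N q : nat)
    (alpha beta : histories R N q) : histories R N q :=
  fun i k => alpha i k - beta i k.

(* A trajectory stands for a function on the integers >= -q with values in R^N:
   its values at times t < -q are never read. *)
Definition trajectory (R : realType) (N : nat) : Type := 'I_N -> int -> R.

Definition segment (R : realType) (N q : nat) (x : trajectory R N) (m : nat)
  : histories R N q :=
  fun i k => x i (m%:Z - k%:Z).

Definition is_solution (R : realType) (N tau : nat)
    (c : 'I_N -> nat -> R) (a : 'I_N -> 'I_N -> nat -> R)
    (b : 'I_N -> 'I_N -> 'I_N -> nat -> R)
    (dtau dxi : 'I_N -> 'I_N -> 'I_N -> nat -> nat)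
    (f g : 'I_N -> R -> R) (x : trajectory R N) : Prop :=
  forall (m : nat) (i : 'I_N),
    x i (m%:Z + 1) =
      c i m * x i (m%:Z - tau%:Z)
      + \sum_(j < N) a i j m * f j (x j m%:Z)
      + \sum_(j < N) \sum_(l < N)
          b i j l m * g j (x j (m%:Z - (dtau i j l m)%:Z))
                    * g l (x l (m%:Z - (dxi i j l m)%:Z)).

Definition periodic_trajectory (R : realType) (N q omega : nat)
    (x : trajectory R N) : Prop :=
  forall (i : 'I_N) (t : int), - q%:Z <= t -> x i (t + omega%:Z) = x i t.

Definition eq_trajectory (R : realType) (N q : nat) (x y : trajectory R N)
  : Prop :=
  forall (i : 'I_N) (t : int), - q%:Z <= t -> x i t = y i t.

(* S is the set of solutions; the solution through alpha is any y in S whose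
   segment at time 0 is alpha; such a y exists, and is unique on the times
   >= -q, because all delays are at most q. *)
Definition globally_exponentially_stable (R : realType) (N q : nat)
    (S : set (trajectory R N)) (x : trajectory R N) : Prop :=
  exists C zeta : R, [/\ 0 < C, 0 < zeta < 1 &
    forall (alpha : histories R N q) (y : trajectory R N),
      S y -> segment y 0 = alpha ->
      forall m : nat,
        histories_norm (histories_sub (segment (q := q) y m) (segment x m)) <=
          C * zeta ^+ m * histories_norm (histories_sub alpha (segment x 0))].

(* Main.v *)
Require Import Defs.
From HB Require Import structures.
From mathcomp Require Import all_boot all_order all_algebra.
From mathcomp Require Import all_classical all_reals.
From mathcomp Require Import interval_inference topology normedtype sequences.
From mathcomp Require Import zify ring lra.

Set Implicit Arguments.
Unset Strict Implicit.
Unset Printing Implicit Defensive.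

Import Order.TTheory GRing.Theory Num.Theory.
Import numFieldNormedType.Exports.
Local Open Scope classical_set_scope.
Local Open Scope ring_scope.

(** The model is a recurrence x(m+1) = step m x whose right-hand side reads x at
    the times m-q, ..., m only. The whole theorem follows from one estimate: in
    the weighted norm max_i |x_i| / d_i, a step contracts differences by a
    factor rho < 1 (model_step_contractive). Indeed, if
    |x_i - y_i| <= d_i M on the window m-q, ..., m, then the Lipschitz bounds,
    the bounds on the g_j and the splitting
    u u' - v v' = v (u' - v') + u' (u - v) of the quadratic terms give
    |step m x i - step m y i| <= L_i M, where L_i (gain) is d_i c_i^+ plus
    the sum over j in the hypothesis on d; that hypothesis is exactly
    L_i < d_i, so rho can be the largest of 1/2 and the L_i / d_i.

    Stability. Choose z in (0,1) with rho <= z^(q+1). A difference of solutions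
    bounded by d_i K z^t up to the time t = m is at most d_i K z^(m-q) on the
    window, hence at most rho d_i K z^(m-q) <= d_i K z^(m+1) at the time m+1.
    So the difference of any two solutions decays like z^t (solutions_close),
    and comparing the weighted norm with the maximum norm makes every solution
    globally exponentially stable (solutions_exponentially_stable).

    Existence. An omega-periodic trajectory is a matrix of N times omega numbers,
    and computing its values at m+1 from those at m, ..., m-q maps such matrices
    to such matrices because the coefficients and delays are omega-periodic. The
    same estimate makes this map a contraction for the maximum norm of the
    rescaled entries x_i(t) / d_i, so the Banach fixed point theorem provides a
    periodic solution (periodic_solution_exists).

    Uniqueness. The difference of two periodic solutions is periodic and tends
    to 0, so it vanishes (periodic_unique). *)

(** * Periodic sequences and the bound on the delays *)

Lemma nat_periodic_modn (T : Type) (omega : nat) (u : nat -> T) (m n : nat) :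
  nat_periodic omega u -> m = n %[mod omega] -> u m = u n.
Proof.
move=> u_per.
have u_perM k r : u (r + k * omega)%N = u r.
  by elim: k => [|k IHk]; rewrite ?addn0 // mulSnr addnA u_per.
move=> emn; rewrite (divn_eq m omega) (divn_eq n omega) emn.
by rewrite ![(_ * omega + _)%N]addnC !u_perM.
Qed.

(** Periodicity is what makes the range bounded, hence its supremum meaningful. *)
Lemma sup_abs_ge (R : realType) (omega : nat) (u : nat -> R) (m : nat) :
  (0 < omega)%N -> nat_periodic omega u -> `|u m| <= sup_abs u.
Proof.
move=> omega_gt0 u_per; apply: ub_le_sup; last by exists m.
exists (\big[Num.max/0]_(s < omega) `|u s|) => _ [n _ <-].
have -> : u n = u (Ordinal (ltn_pmod n omega_gt0)).
  by apply: (nat_periodic_modn u_per); rewrite modn_mod.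
exact: (le_bigmax _ (fun s : 'I_omega => `|u s|)).
Qed.

(** By periodicity only finitely many delays occur, so a greatest one exists and
    the default value in the definition of max_delay is never taken. *)
Lemma delay_le_max (N omega tau : nat)
    (dtau dxi : 'I_N -> 'I_N -> 'I_N -> nat -> nat) (k : nat) :
  (0 < omega)%N ->
  (forall i j l, nat_periodic omega (dtau i j l)) ->
  (forall i j l, nat_periodic omega (dxi i j l)) ->
  delays tau dtau dxi k -> (k <= max_delay tau dtau dxi)%N.
Proof.
move=> omega_gt0 dtau_per dxi_per.
pose bound := maxn tau (\max_(p : 'I_N * 'I_N * 'I_N * 'I_omega)
  maxn (dtau p.1.1.1 p.1.1.2 p.1.2 p.2) (dxi p.1.1.1 p.1.1.2 p.1.2 p.2)).
have delay_le k' : `[< delays tau dtau dxi k' >] -> (k' <= bound)%N.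
  move=> /asboolP[->|[i [j [l [m k'E]]]]]; first exact: leq_maxl.
  apply: leq_trans (leq_maxr _ _).
  pose s := Ordinal (ltn_pmod m omega_gt0).
  have m_s : m = s %[mod omega] by rewrite modn_mod.
  apply: leq_trans (leq_bigmax (i, j, l, s)) => /=.
  rewrite leq_max; case: k'E => ->.
  - by rewrite (nat_periodic_modn (dtau_per i j l) m_s) leqnn.
  - by rewrite (nat_periodic_modn (dxi_per i j l) m_s) leqnn orbT.
have delay_ex : exists k', `[< delays tau dtau dxi k' >].
  by exists tau; apply/asboolP; left.
suff [_ ub] : [set k | delays tau dtau dxi k /\
    forall k', delays tau dtau dxi k' -> (k' <= k)%N] (max_delay tau dtau dxi).
  exact: ub.
apply: xgetPex; have [M /asboolP MD Mub] := ex_maxnP delay_ex delay_le.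
by exists M; split=> // k' /asboolP; exact: Mub.
Qed.

Lemma le_histories_norm (R : realType) (N q : nat) (alpha : histories R N q) i k :
  `|alpha i k| <= histories_norm alpha.
Proof.
apply: le_trans (le_bigmax 0 (fun i => history_norm (alpha i)) i).
exact: (le_bigmax 0 (fun k => `|alpha i k|) k).
Qed.

(** * Exponential stability of contractive delay recurrences *)

(** Bernoulli's inequality for a nonpositive increment. *)
Lemma bernoulli_sub (R : realDomainType) (e : R) (n : nat) :
  0 <= e <= 1 -> 1 - e *+ n <= (1 - e) ^+ n.
Proof.
move=> /andP[e_ge0 e_le1]; elim: n => [|n IHn]; first by rewrite mulr0n subr0 expr0.
have e1_ge0 : 0 <= 1 - e by rewrite subr_ge0.
rewrite exprS; apply: le_trans (ler_wpM2l e1_ge0 IHn).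
have : 0 <= e *+ n by rewrite mulrn_wge0.
rewrite mulrSr; nra.
Qed.

Section Contraction.
Context {R : realType} {N : nat} (q : nat).
Context (step : nat -> trajectory R N -> 'I_N -> R).
Context (d : 'I_N -> R) (rho : R).
Hypothesis d_gt0 : forall i, 0 < d i.

Definition solves (x : trajectory R N) : Prop :=
  forall m i, x i (m%:Z + 1) = step m x i.

(** The Lipschitz condition of constant rho for the norm max_i |x_i| / d_i, with
    the bound M on the window m-q, ..., m given as a variable: this avoids
    naming the norm of a window. *)
Definition contractive : Prop :=
  forall (m : nat) (x y : trajectory R N) (M : R), 0 <= M ->
    (forall i k, (k <= q)%N ->
       `|x i (m%:Z - k%:Z) - y i (m%:Z - k%:Z)| <= d i * M) ->
    forall i, `|step m x i - step m y i| <= d i * (rho * M).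

Hypothesis step_contr : contractive.

(** The times are shifted by q so that all exponents of z are natural numbers;
    K z^n is thus the bound at the time n - q. A new value is one contraction
    step away from a window reaching q+1 times back, which costs exactly the
    factor z^(q+1) that rho pays for. *)
Lemma solutions_close (x y : trajectory R N) (z K : R) :
  0 < z <= 1 -> rho <= z ^+ q.+1 -> 0 <= K -> solves x -> solves y ->
  (forall i (k : nat), (k <= q)%N ->
     `|x i (- k%:Z) - y i (- k%:Z)| <= d i * (K * z ^+ q)) ->
  forall (n : nat) i,
    `|x i (n%:Z - q%:Z) - y i (n%:Z - q%:Z)| <= d i * (K * z ^+ n).
Proof.
move=> /andP[z_gt0 z_le1] rho_le K_ge0 xS yS close0.
have zX_le a b : (a <= b)%N -> z ^+ b <= z ^+ a.
  by move=> ab; apply: ler_wiXn2l => //; exact: ltW.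
elim/ltn_ind => n IH i; case: (leqP n q) => [n_le_q | q_lt_n].
  have -> : n%:Z - q%:Z = - (q - n)%N%:Z by lia.
  apply: le_trans (close0 i _ (leq_subr n q)) _.
  by rewrite ler_pM2l // ler_wpM2l // zX_le.
have [m nE] : exists m, n = (m + q.+1)%N by exists (n - q.+1)%N; lia.
have -> : n%:Z - q%:Z = m%:Z + 1 by lia.
rewrite xS yS; apply: le_trans (step_contr _ (M := K * z ^+ m) _ i) _.
- by rewrite mulr_ge0 // exprn_ge0 // ltW.
- move=> j k k_le_q.
  have -> : m%:Z - k%:Z = (m + q - k)%N%:Z - q%:Z by lia.
  apply: le_trans (IH (m + q - k)%N _ j) _; first by lia.
  by rewrite ler_pM2l // ler_wpM2l // zX_le //; lia.
- rewrite ler_pM2l // mulrCA ler_wpM2l // nE exprD mulrC ler_wpM2l //.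
  by rewrite exprn_ge0 // ltW.
Qed.

Hypothesis rho_range : 0 < rho < 1.

(** Bernoulli's inequality makes z = 1 - (1 - rho) / (q+1) suitable without
    extracting a root; rho > 0 is used to get z > 0 when q = 0. *)
Lemma decay_rate : exists2 z : R, 0 < z < 1 & rho <= z ^+ q.+1.
Proof.
have /andP[rho_gt0 rho_lt1] := rho_range.
pose e := (1 - rho) / q.+1%:R.
have e_gt0 : 0 < e by rewrite divr_gt0 ?subr_gt0.
have eE : e *+ q.+1 = 1 - rho by rewrite -mulr_natr divfK ?pnatr_eq0.
have e_le : e <= 1 - rho by rewrite -eE mulrS lerDl mulrn_wge0 // ltW.
exists (1 - e); first by lra.
have := @bernoulli_sub R e q.+1; rewrite eE opprB addrC subrK; apply.
by lra.
Qed.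

(** The constants D and B convert between the weighted and the maximum norm, and
    z^q absorbs the time shift of solutions_close. *)
Lemma solutions_exponentially_stable (x : trajectory R N) :
  solves x -> globally_exponentially_stable q [set y | solves y] x.
Proof.
move=> xS; have [z /andP[z_gt0 z_lt1] rho_le] := decay_rate.
(* Starting both maxima at 1 makes them positive. *)
pose D := \big[Num.max/1]_i d i; pose B := \big[Num.max/1]_i (d i)^-1.
have D_gt0 : 0 < D by apply: lt_le_trans ltr01 (bigmax_ge_id _ _ _ _).
have B_gt0 : 0 < B by apply: lt_le_trans ltr01 (bigmax_ge_id _ _ _ _).
have zq_gt0 : 0 < z ^+ q by rewrite exprn_gt0.
exists (D * B / z ^+ q), z; split; rewrite ?divr_gt0 ?mulr_gt0 ?z_gt0 //.
move=> _ y yS <- m.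
pose alpha := histories_sub (segment (q := q) y 0) (segment x 0).
rewrite -/alpha; set eta := histories_norm alpha.
have eta_ge0 : 0 <= eta by exact: bigmax_ge_id.
pose K := eta * B / z ^+ q.
have K_ge0 : 0 <= K by rewrite !mulr_ge0 // ?invr_ge0 ltW.
have close0 i (k : nat) : (k <= q)%N ->
    `|y i (- k%:Z) - x i (- k%:Z)| <= d i * (K * z ^+ q).
  move=> k_le_q; rewrite /K divfK ?gt_eqF //.
  apply: (@le_trans _ _ eta).
    have := le_histories_norm alpha i (inord k).
    by rewrite /alpha /histories_sub /segment inordK ?ltnS // !sub0r.
  rewrite mulrCA -[leLHS]mulr1 ler_wpM2l // -ler_pdivrMl // mulr1.
  exact: (le_bigmax _ (fun i => (d i)^-1)).
have close := solutions_close _ rho_le K_ge0 yS xS close0.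
have bound_ge0 : 0 <= D * B / z ^+ q * z ^+ m * eta.
  by rewrite !mulr_ge0 // ?invr_ge0 ?exprn_ge0 // ltW.
apply: bigmax_le => // i _; apply: bigmax_le => // k _.
rewrite /histories_sub /segment.
have k_le_q : (k <= q)%N by rewrite -ltnS.
have -> : m%:Z - k%:Z = (m + q - k)%N%:Z - q%:Z by lia.
apply: le_trans (close _ _ i) _; first by rewrite z_gt0 ltW.
have -> : D * B / z ^+ q * z ^+ m * eta = D * (K * z ^+ m) by rewrite /K; ring.
rewrite ler_pM ?(ltW (d_gt0 i)) //.
- by rewrite mulr_ge0 // exprn_ge0 // ltW.
- exact: le_bigmax.
- by rewrite ler_wpM2l // ler_wiXn2l ?ltW //; lia.
Qed.

End Contraction.

(** Stability bounds the difference at t + j * omega by a multiple of z^n, and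
    periodicity carries this bound back to t for every n. *)
Lemma periodic_unique (R : realType) (N q omega : nat)
    (S : set (trajectory R N)) (x y : trajectory R N) :
  (0 < omega)%N -> globally_exponentially_stable q S x ->
  periodic_trajectory q omega x -> S y -> periodic_trajectory q omega y ->
  eq_trajectory q y x.
Proof.
move=> omega_gt0 [C [z [C_gt0 /andP[z_gt0 z_lt1] stable]]] x_per yS y_per i t t_ge.
have periodM (u : trajectory R N) n : periodic_trajectory q omega u ->
    u i (t + (n * omega)%N%:Z) = u i t.
  move=> u_per; elim: n => [|n <-]; first by rewrite mul0n addr0.
  have -> : t + (n.+1 * omega)%N%:Z = t + (n * omega)%N%:Z + omega%:Z by lia.
  by rewrite u_per //; lia.
pose K := C * histories_norm (histories_sub (segment (q := q) y 0) (segment x 0)).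
have close n : `|y i t - x i t| <= K * z ^+ n.
  (* As t >= - q, moving n + q periods ahead reaches a time m >= n. *)
  pose j := (n + q)%N.
  have [m mE] : exists m : nat, m%:Z = t + (j * omega)%N%:Z.
    by exists `|(t + (j * omega)%N%:Z)%R|%N; rewrite /j; nia.
  have n_le_m : (n <= m)%N by rewrite /j in mE; nia.
  have -> : y i t - x i t = histories_sub (segment (q := q) y m) (segment x m) i ord0.
    by rewrite /histories_sub /segment subr0 mE !periodM.
  apply: le_trans (le_histories_norm _ _ _) _.
  apply: le_trans (stable _ y yS erefl m) _.
  rewrite /K mulrAC ler_wpM2l //; last by rewrite ler_wiXn2l // ltW.
  by rewrite mulr_ge0 ?(ltW C_gt0) //; exact: bigmax_ge_id.
have K_cvg : K * z ^+ n @[n --> \oo] --> K * 0.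
  by apply: cvgMr; apply: cvg_expr; rewrite gtr0_norm.
apply/eqP; rewrite -subr_eq0 -normr_le0 -(mulr0 K).
rewrite -(cvg_lim _ K_cvg) //; apply: limr_ge; first by apply/cvg_ex; exists (K * 0).
by apply: nearW => n; exact: close.
Qed.

(** * Existence of a periodic solution *)

(** Joins the completeness of matrix spaces to their norm, so that the Banach
    fixed point theorem applies to them. *)
HB.instance Definition _ (R : realType) (m n : nat) := Complete.on 'M[R]_(m, n).

Section PeriodicSolution.
Context {R : realType} {N : nat} (q omega : nat).
Context (step : nat -> trajectory R N -> 'I_N -> R).
Context (d : 'I_N -> R) (rho : R).
Hypothesis omega_gt0 : (0 < omega)%N.
Hypothesis d_gt0 : forall i, 0 < d i.
Hypothesis rho_range : 0 < rho < 1.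
Hypothesis step_contr : contractive q step d rho.
Hypothesis step_per : forall (x : trajectory R N) (m n : nat),
  (forall i t, x i (t + omega%:Z) = x i t) ->
  m = n %[mod omega] -> step m x = step n x.

Definition phase (t : int) : 'I_omega :=
  Ordinal (ltn_pmod `|(t %% omega)%Z|%N omega_gt0).

Lemma phaseE t : (phase t)%:Z = (t %% omega)%Z.
Proof.
have omegaz_gt0 : 0 < omega%:Z by [].
have := modz_ge0 t (lt0r_neq0 omegaz_gt0); have := ltz_pmod t omegaz_gt0.
rewrite /phase /=; case: (t %% omega)%Z => // r r_lt _.
by rewrite absz_nat modn_small.
Qed.

(** The entries are stored divided by d i: the maximum norm of the matrices is
    then the weighted norm in which a step contracts. *)
Definition unroll (p : 'M[R]_(N, omega)) : trajectory R N :=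
  fun i t => d i * p i (phase t).

Lemma unroll_periodic p i t : unroll p i (t + omega%:Z) = unroll p i t.
Proof.
rewrite /unroll; congr (_ * p i _); apply/val_inj/eqP.
by rewrite -eqz_nat !phaseE modzDr.
Qed.

(** The value at the phase s is computed from the time s - 1; that time is moved
    one period ahead, to s + omega.-1, so that it is a natural number. *)
Definition period_map (p : 'M[R]_(N, omega)) : 'M[R]_(N, omega) :=
  \matrix_(i, s) (step (s + omega.-1) (unroll p) i / d i).

Lemma norm_entry (p : 'M[R]_(N, omega)) i s : `|p i s| <= `|p|.
Proof.
by rewrite [leRHS]mx_normrE; exact: (le_bigmax 0 (fun ij => `|p ij.1 ij.2|) (i, s)).
Qed.

Lemma period_map_contr p p' :
  `|period_map p - period_map p'| <= rho * `|p - p'|.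
Proof.
have /andP[rho_gt0 rho_lt1] := rho_range.
rewrite [leLHS]mx_normrE; apply: bigmax_le => [|[i s] _ /=].
  by rewrite mulr_ge0 // ltW.
rewrite !mxE -mulrBl normrM [`|(d i)^-1|]gtr0_norm ?invr_gt0 //.
rewrite ler_pdivrMr // mulrC; apply: step_contr => // j k _.
rewrite /unroll -mulrBr normrM gtr0_norm // ler_pM2l //.
by have := norm_entry (p - p') j (phase ((s + omega.-1)%N%:Z - k%:Z)); rewrite !mxE.
Qed.

Lemma periodic_solution_exists :
  exists2 x, solves step x & periodic_trajectory q omega x.
Proof.
have /andP[rho_gt0 rho_lt1] := rho_range.
have T_contr : is_contraction [fun of totalfun period_map].
  exists (NngNum (ltW rho_gt0)); split=> //= -[p p'] _ /=.
  exact: period_map_contr.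
have [p _ pE] := banach_fixed_point T_contr closedT (ex_intro _ 0 I).
exists (unroll p); last by move=> i t _; exact: unroll_periodic.
move=> m i; rewrite /unroll {1}pE mxE mulrC divfK ?gt_eqF //.
apply: (congr1 (@^~ i)); apply: step_per => [j t|]; first exact: unroll_periodic.
have -> : phase (m%:Z + 1) = (m.+1 %% omega)%N :> nat.
  by rewrite /phase /= -PoszD addn1 modz_nat absz_nat modn_mod.
by rewrite modnDml addSnnS prednK // modnDr.
Qed.

End PeriodicSolution.

(** * The contraction estimate for the model *)

Definition model_step (R : realType) (N tau : nat)
    (c : 'I_N -> nat -> R) (a : 'I_N -> 'I_N -> nat -> R)
    (b : 'I_N -> 'I_N -> 'I_N -> nat -> R)
    (dtau dxi : 'I_N -> 'I_N -> 'I_N -> nat -> nat)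
    (f g : 'I_N -> R -> R) (m : nat) (x : trajectory R N) (i : 'I_N) : R :=
  c i m * x i (m%:Z - tau%:Z)
  + \sum_(j < N) a i j m * f j (x j m%:Z)
  + \sum_(j < N) \sum_(l < N)
      b i j l m * g j (x j (m%:Z - (dtau i j l m)%:Z))
                * g l (x l (m%:Z - (dxi i j l m)%:Z)).

(** A bound on the change of the i-th component of a step when its arguments
    change by at most d; the hypothesis on d says, with its c-term moved to the
    other side, that it is less than d i. *)
Definition gain (R : realType) (N : nat) (c : 'I_N -> nat -> R)
    (a : 'I_N -> 'I_N -> nat -> R) (b : 'I_N -> 'I_N -> 'I_N -> nat -> R)
    (F G mg d : 'I_N -> R) (i : 'I_N) : R :=
  d i * sup_abs (c i)
  + \sum_(j < N) (d j * F j * sup_abs (a i j)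
      + \sum_(l < N) sup_abs (b i j l) * (mg j * d l * G l + mg l * d j * G j)).

Lemma lipschitz_ge0 (R : realType) (h : R -> R) (L : R) :
  (forall x y, `|h x - h y| <= L * `|x - y|) -> 0 <= L.
Proof.
by move=> /(_ 1 0)/(le_trans (normr_ge0 _)); rewrite subr0 normr1 mulr1.
Qed.

Section Model.
Context {R : realType} {N omega tau : nat}.
Context {c : 'I_N -> nat -> R} {a : 'I_N -> 'I_N -> nat -> R}.
Context {b : 'I_N -> 'I_N -> 'I_N -> nat -> R}.
Context {dtau dxi : 'I_N -> 'I_N -> 'I_N -> nat -> nat}.
Context {f g : 'I_N -> R -> R} {F G mg : 'I_N -> R}.
Hypothesis omega_gt0 : (0 < omega)%N.
Hypothesis c_per : forall i, nat_periodic omega (c i).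
Hypothesis dtau_per : forall i j l, nat_periodic omega (dtau i j l).
Hypothesis dxi_per : forall i j l, nat_periodic omega (dxi i j l).
Hypothesis a_per : forall i j, nat_periodic omega (a i j).
Hypothesis b_per : forall i j l, nat_periodic omega (b i j l).

Local Notation step := (model_step tau c a b dtau dxi f g).
Local Notation q := (max_delay tau dtau dxi).
Local Notation gain := (gain c a b F G mg).

Lemma model_step_periodic (x : trajectory R N) (m n : nat) :
  (forall i t, x i (t + omega%:Z) = x i t) ->
  m = n %[mod omega] -> step m x = step n x.
Proof.
move=> x_per mn; apply/funext => i.
(* The delays depend on the time too, so k and k' stand for one delay at m and n. *)
have xE j (k k' : nat) : k = k' ->
    x j (m%:Z - k%:Z) = x j (n%:Z - k'%:Z).
  move=> <-.
  pose u (r : nat) := x j (r%:Z - k%:Z).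
  apply: (@nat_periodic_modn _ omega u) mn => r; rewrite /u -(x_per j (r%:Z - k%:Z)).
  by rewrite PoszD addrAC.
have x0E j : x j m%:Z = x j n%:Z by have := xE j 0%N 0%N erefl; rewrite !subr0.
rewrite /model_step (nat_periodic_modn (c_per i) mn) (xE i tau tau) //.
congr (_ + _ + _); apply: eq_bigr => j _.
  by rewrite (nat_periodic_modn (a_per i j) mn) x0E.
apply: eq_bigr => l _; rewrite (nat_periodic_modn (b_per i j l) mn).
by rewrite !(xE _ _ _ (nat_periodic_modn _ mn)).
Qed.

Hypothesis f_lip : forall j x y, `|f j x - f j y| <= F j * `|x - y|.
Hypothesis g_lip : forall j x y, `|g j x - g j y| <= G j * `|x - y|.
Hypothesis g_bound : forall j x, `|g j x| <= mg j.

(** Every time read by the model lies in the window m-q, ..., m, because q bounds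
    all delays; there the Lipschitz bounds apply term by term. *)
Lemma model_step_gain (d : 'I_N -> R) (m : nat) (x y : trajectory R N) (M : R) :
  (forall i (k : nat), (k <= q)%N ->
     `|x i (m%:Z - k%:Z) - y i (m%:Z - k%:Z)| <= d i * M) ->
  forall i, `|step m x i - step m y i| <= gain d i * M.
Proof.
move=> xy_le i.
have delay_le_q k : delays tau dtau dxi k -> (k <= q)%N.
  exact: delay_le_max omega_gt0 dtau_per dxi_per.
have xy_le0 j : `|x j m%:Z - y j m%:Z| <= d j * M.
  by have := xy_le j 0%N (leq0n _); rewrite !subr0.
have dM_ge0 j : 0 <= d j * M by apply: le_trans (xy_le0 j).
have F_ge0 j := lipschitz_ge0 (f_lip j).
have G_ge0 j := lipschitz_ge0 (g_lip j).
have f_le j u v : `|u - v| <= d j * M -> `|f j u - f j v| <= F j * (d j * M).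
  by move=> /(ler_wpM2l (F_ge0 j)); apply: le_trans.
have g_le j u v : `|u - v| <= d j * M -> `|g j u - g j v| <= G j * (d j * M).
  by move=> /(ler_wpM2l (G_ge0 j)); apply: le_trans.
have -> : step m x i - step m y i =
    c i m * (x i (m%:Z - tau%:Z) - y i (m%:Z - tau%:Z))
    + \sum_(j < N) (a i j m * (f j (x j m%:Z) - f j (y j m%:Z))
      + \sum_(l < N) b i j l m *
        (g j (x j (m%:Z - (dtau i j l m)%:Z))
           * g l (x l (m%:Z - (dxi i j l m)%:Z))
         - g j (y j (m%:Z - (dtau i j l m)%:Z))
           * g l (y l (m%:Z - (dxi i j l m)%:Z)))).
  rewrite /model_step mulrBr big_split /=.
  under [X in _ = _ + (X + _)]eq_bigr do rewrite mulrBr.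
  under [X in _ = _ + (_ + X)]eq_bigr do
    under eq_bigr do rewrite mulrBr !mulrA.
  rewrite sumrB; under [X in _ = _ + (_ + X)]eq_bigr do rewrite sumrB.
  rewrite sumrB; ring.
rewrite /gain mulrDl; apply: le_trans (ler_normD _ _) (lerD _ _).
  rewrite normrM mulrAC [leRHS]mulrC ler_pM //.
    exact: sup_abs_ge omega_gt0 (c_per i).
  by apply: xy_le; apply: delay_le_q; left.
rewrite mulr_suml; apply: le_trans (ler_norm_sum _ _ _) _.
apply: ler_sum => j _; rewrite mulrDl.
apply: le_trans (ler_normD _ _) (lerD _ _).
  have -> : d j * F j * sup_abs (a i j) * M =
      sup_abs (a i j) * (F j * (d j * M)) by ring.
  rewrite normrM ler_pM ?f_le //.
  exact: sup_abs_ge omega_gt0 (a_per i j).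
rewrite mulr_suml; apply: le_trans (ler_norm_sum _ _ _) _.
apply: ler_sum => l _; rewrite normrM -mulrA ler_pM //.
  exact: sup_abs_ge omega_gt0 (b_per i j l).
set gx := g j _; set gx' := g l _; set gy := g j _; set gy' := g l _.
have -> : gx * gx' - gy * gy' = gy * (gx' - gy') + gx' * (gx - gy) by ring.
rewrite mulrDl; apply: le_trans (ler_normD _ _) (lerD _ _).
- rewrite normrM -!mulrA ler_pM ?g_bound // [d l * _]mulrCA.
  by apply: g_le; apply: xy_le; apply: delay_le_q; right; exists i, j, l, m; right.
- rewrite normrM -!mulrA ler_pM ?g_bound // [d j * _]mulrCA.
  by apply: g_le; apply: xy_le; apply: delay_le_q; right; exists i, j, l, m; left.
Qed.

(** The maximum defining rho starts at 1/2 rather than 0 because decay_rate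
    requires rho > 0. *)
Lemma model_step_contractive (d : 'I_N -> R) :
  (forall i, 0 < d i) -> (forall i, gain d i < d i) ->
  exists2 rho, 0 < rho < 1 & contractive q step d rho.
Proof.
move=> d_gt0 gain_lt.
pose rho := \big[Num.max/2^-1]_i (gain d i / d i).
have rho_ge : 2^-1 <= rho by exact: bigmax_ge_id.
exists rho.
  apply/andP; split; first by apply: lt_le_trans rho_ge; rewrite invr_gt0.
  apply: bigmax_lt => [|i _]; first by rewrite invf_lt1 // ltr1n.
  by rewrite ltr_pdivrMr // mul1r.
move=> m x y M M_ge0 xy_le i; apply: le_trans (model_step_gain xy_le i) _.
rewrite mulrA ler_wpM2r // mulrC -ler_pdivrMr //.
exact: (le_bigmax _ (fun i => gain d i / d i)).
Qed.

End Model.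

Theorem corollary6 (R : realType) (N omega tau : nat)
    (c : 'I_N -> nat -> R) (a : 'I_N -> 'I_N -> nat -> R)
    (b : 'I_N -> 'I_N -> 'I_N -> nat -> R)
    (dtau dxi : 'I_N -> 'I_N -> 'I_N -> nat -> nat)
    (f g : 'I_N -> R -> R) (F G mg : 'I_N -> R)
    (N_gt0 : (0 < N)%N) (omega_gt0 : (0 < omega)%N)
    (c_range : forall i m, -1 < c i m < 1)
    (c_per : forall i, nat_periodic omega (c i))
    (dtau_per : forall i j l, nat_periodic omega (dtau i j l))
    (dxi_per : forall i j l, nat_periodic omega (dxi i j l))
    (a_per : forall i j, nat_periodic omega (a i j))
    (b_per : forall i j l, nat_periodic omega (b i j l))
    (f_lip : forall j x y, `|f j x - f j y| <= F j * `|x - y|)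
    (g_lip : forall j x y, `|g j x - g j y| <= G j * `|x - y|)
    (mg_gt0 : forall j, 0 < mg j)
    (g_bound : forall j x, `|g j x| <= mg j)
    (d_cond : exists d : 'I_N -> R,
       (forall i, 0 < d i) /\
       (forall i,
          \sum_(j < N) (d j * F j * sup_abs (a i j)
            + \sum_(l < N) sup_abs (b i j l)
                * (mg j * d l * G l + mg l * d j * G j))
          < d i * (1 - sup_abs (c i)))) :
  let q := max_delay tau dtau dxi in
  let S := [set x | is_solution tau c a b dtau dxi f g x] in
  exists x : trajectory R N,
    [/\ S x,
        periodic_trajectory q omega x,
        (forall y : trajectory R N,
           S y -> periodic_trajectory q omega y -> eq_trajectory q y x) &
        globally_exponentially_stable q S x].
Proof.
move=> q S; have [d [d_gt0 d_lt]] := d_cond.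
have gain_lt i : gain c a b F G mg d i < d i.
  by have := d_lt i; rewrite mulrBr mulr1 ltrBrDl.
have [rho rho_range step_contr] := model_step_contractive (tau := tau)
  omega_gt0 c_per dtau_per dxi_per a_per b_per f_lip g_lip g_bound d_gt0 gain_lt.
have step_per x m n := @model_step_periodic _ _ _ tau _ _ _ _ _ f g
  c_per dtau_per dxi_per a_per b_per x m n.
have [x xS x_per] :=
  periodic_solution_exists omega_gt0 d_gt0 rho_range step_contr step_per.
have x_stable := solutions_exponentially_stable d_gt0 step_contr rho_range xS.
exists x; split; [exact: xS | exact: x_per | | exact: x_stable].
by move=> y yS; exact: periodic_unique omega_gt0 x_stable x_per yS.
Qed.
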